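(* A graph $G=(V,E)$ is a unique key graph if and only if for every maximal independent set $I\subseteq V$ of $G$ and every vertex $v\in I$ there exists a vertex $u\notin I$ that is an individual neighbor of $v$ with respect to $I$, i.e., $N(u)\cap I=\{v\}$.
   Context: $N(u)$ denotes the set of neighbors of $u$ in $G$. A pure Horn clause $A\to v$ ($A\subseteq V$, $v\in V$) stands for $v\vee\bigvee_{a\in A}\bar a$; a Boolean function $h:\{0,1\}^V\to\{0,1\}$ is pure Horn if it is a conjunction of such clauses; $A\to v$ is an implicate of $h$ if every true point of $h$ satisfies it; $K\subseteq V$ is a key of $h$ if $K\to w$ is an implicate for all $w\in V\setminus K$; $\mathcal{K}(h)$ is the family of minimal keys. A Sperner hypergraph $\mathcal{B}\subseteq 2^V$ is a unique key hypergraph if there is exactly one pure Horn function $h$ on $V$ with $\mathcal{K}(h)=\mathcal{B}$. A graph $G=(V,E)$ is a unique key graph if its edge set $E$, viewed as a hypergraph of $2$-element subsets of $V$, is a unique key hypergraph. *)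

(* Defs.v *)
From mathcomp Require Import all_boot.
Set Implicit Arguments. Unset Strict Implicit. Unset Printing Implicit Defensive.

Section Horn.
Variable V : finType.

Definition point := {ffun V -> bool}.

(* Finite functions are used so that equality of Boolean functions, needed for
   uniqueness below, is extensional. *)
Definition boolfun := {ffun point -> bool}.

(* Membership of v in A is allowed; the clause is then a tautology. *)
Definition clause_sat (A : {set V}) (v : V) (x : point) : bool :=
  x v || [exists a in A, ~~ x a].

(* The empty conjunction is allowed, so the constant true function is pure
   Horn. *)
Definition pure_horn (h : boolfun) : Prop :=
  exists C : {set {set V} * V},
    forall x : point, h x = [forall c in C, clause_sat c.1 c.2 x].

Definition implicate (h : boolfun) (A : {set V}) (v : V) : bool :=
  [forall x : point, h x ==> clause_sat A v x].

Definition key (h : boolfun) (K : {set V}) : bool :=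
  [forall w in ~: K, implicate h K w].

Definition minimal_keys (h : boolfun) : {set {set V}} :=
  [set K | minset (key h) K].

Definition sperner (B : {set {set V}}) : Prop :=
  {in B &, forall S T : {set V}, S \subset T -> S = T}.

Definition unique_key_hypergraph (B : {set {set V}}) : Prop :=
  sperner B /\ exists! h : boolfun, pure_horn h /\ minimal_keys h = B.

End Horn.

Section Graph.
(* A graph is given by its adjacency relation, assumed symmetric and
   irreflexive wherever it is used. *)
Variables (V : finType) (e : rel V).

Definition edges : {set {set V}} := [set [set p.1; p.2] | p : V * V & e p.1 p.2].

Definition neighbors (u : V) : {set V} := [set w | e u w].

Definition independent (I : {set V}) : bool :=
  [forall x in I, forall y in I, ~~ e x y].

Definition maximal_independent (I : {set V}) : bool := maxset independent I.

Definition unique_key_graph : Prop := unique_key_hypergraph edges.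

End Graph.

(* Main.v *)
(** Identify a pure Horn function with the intersection-closed family of supports
    of its true points.  Its minimal keys are the edges of [e] iff its maximal
    proper closed sets are the maximal independent sets of [e].  The largest such
    family consists of [V] and all independent sets, so uniqueness says that
    every independent set is an intersection of maximal ones; this can be tested
    on the sets [I :\ v] with [I] maximal independent and [v] in [I].  A maximal
    independent set that contains [I :\ v] but not [v] exists exactly when [v] has
    an individual neighbor with respect to [I]. *)
Require Import Defs.
From mathcomp Require Import all_boot.

(** * Pure Horn functions as closure systems of supports *)

Section PureHorn.
Set Implicit Arguments.
Unset Strict Implicit.
Variable V : finType.
Implicit Types (x : point V) (h : boolfun V) (A K X : {set V}) (v w : V)
  (C : {set {set V} * V}).

Definition support x : {set V} := [set v | x v].

Definition indicator X : point V := [ffun v => v \in X].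

Lemma indicatorK : cancel indicator support.
Proof. by move=> X; apply/setP=> v; rewrite inE ffunE. Qed.

Lemma supportK : cancel support indicator.
Proof. by move=> x; apply/ffunP=> v; rewrite ffunE inE. Qed.

Lemma clause_satE A v x :
  clause_sat A v x = ((A \subset support x) ==> (v \in support x)).
Proof.
rewrite /clause_sat inE; case: (x v); rewrite ?implybT //= implybF.
apply/existsP/subsetPn => [[a /andP[aA xa]] | [a aA]].
  by exists a => //; rewrite inE.
by rewrite inE => xa; exists a; rewrite aA.
Qed.

Lemma keyP h K :
  reflect (forall x, h x -> K \subset support x -> support x = setT) (key h K).
Proof.
apply: (iffP forall_inP) => [keyK x hx sKx | keyK w _].
  apply/setP=> w; rewrite in_setT; have [/(subsetP sKx)// | wK] := boolP (w \in K).
  have /forallP/(_ x) : implicate h K w by apply: keyK; rewrite inE.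
  by rewrite hx clause_satE sKx.
apply/forallP=> x; apply/implyP=> hx; rewrite clause_satE.
by apply/implyP=> sKx; rewrite (keyK x) ?in_setT.
Qed.

Lemma keyS h A K : A \subset K -> key h A -> key h K.
Proof.
move=> sAK /keyP keyA; apply/keyP=> x hx sKx.
exact: keyA hx (subset_trans sAK sKx).
Qed.

Definition horn C : boolfun V :=
  [ffun x => [forall c in C, clause_sat c.1 c.2 x]].

Lemma pure_horn_horn C : pure_horn (horn C).
Proof. by exists C => x; rewrite ffunE. Qed.

Lemma hornP C x :
  reflect (forall A v, (A, v) \in C -> A \subset support x -> v \in support x)
          (horn C x).
Proof.
rewrite ffunE; apply: (iffP forall_inP) => [Cx A v /Cx | Cx [A v] /Cx].
  by rewrite clause_satE => /implyP.
by rewrite clause_satE => /implyP.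
Qed.

(** Closure under intersection, stated without forming intersections: [X] is the intersection of the
    chosen sets [Y]. A clause with head [w] that fails at [X] also fails at the [Y] omitting [w],
    because that [Y] contains the body. For [X = setT] the condition is vacuous. *)
Lemma pure_horn_separated h X : pure_horn h ->
  (forall w, w \notin X -> exists Y : {set V},
     [/\ X \subset Y, w \notin Y & h (indicator Y)]) ->
  h (indicator X).
Proof.
case=> C hE sep; rewrite hE; apply/forall_inP=> -[A w] cC; rewrite clause_satE /=.
apply/implyP; rewrite indicatorK => sAX; apply: contraT => /sep[Y [sXY wY]].
rewrite hE => /forall_inP/(_ _ cC); rewrite clause_satE /= indicatorK.
by rewrite (subset_trans sAX sXY) (negPf wY).
Qed.

End PureHorn.

(** * Edges, independent sets and individual neighbors *)

Section UniqueKeyGraph.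
Set Implicit Arguments.
Unset Strict Implicit.
Variables (V : finType) (e : rel V).
Hypotheses (e_sym : symmetric e) (e_irr : irreflexive e).
Implicit Types (h : boolfun V) (I J K X : {set V}) (u v w : V).

Lemma independentP X :
  reflect (forall v w, v \in X -> w \in X -> ~~ e v w) (independent e X).
Proof.
apply: (iffP forall_inP) => [indX v w /indX/forall_inP | indX v vX]; first exact.
by apply/forall_inP=> w; apply: indX.
Qed.

Lemma independentPn X :
  reflect (exists v w, [/\ v \in X, w \in X & e v w]) (~~ independent e X).
Proof.
apply: (iffP idP) => [|[v [w [vX wX evw]]]]; last first.
  by apply/negP=> /independentP/(_ v w vX wX); rewrite evw.
case/forall_inPn=> v vX /forall_inPn[w wX /negPn evw].
by exists v, w.
Qed.

Lemma independentS X K : X \subset K -> independent e K -> independent e X.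
Proof.
move=> /subsetP sXK /independentP indK.
by apply/independentP=> v w /sXK vK /sXK; apply: indK.
Qed.

Lemma card_edge K : K \in edges e -> #|K| = 2.
Proof.
case/imsetP=> -[v w]; rewrite inE /= => evw ->; rewrite cards2.
by case: eqVneq evw => // ->; rewrite e_irr.
Qed.

Lemma sperner_edges : sperner (edges e).
Proof.
move=> S T eS eT sST; apply/eqP.
by rewrite eqEcard sST (card_edge eS) (card_edge eT).
Qed.

Lemma edge_dependent K : K \in edges e -> ~~ independent e K.
Proof.
case/imsetP=> -[v w]; rewrite inE /= => evw ->; apply/independentPn.
by exists v, w; rewrite !inE !eqxx orbT.
Qed.

Lemma dependent_edge K :
  ~~ independent e K -> exists2 S, S \in edges e & S \subset K.
Proof.
case/independentPn=> v [w [vK wK evw]]; exists [set v; w].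
  by apply/imsetP; exists (v, w); rewrite ?inE.
by rewrite subUset !sub1set vK.
Qed.

Lemma minset_dependent K :
  minset (fun X => ~~ independent e X) K = (K \in edges e).
Proof.
apply/minsetP/idP => [[/dependent_edge[S eS sSK] minK] | eK].
  by rewrite -(minK S) ?edge_dependent.
split=> [|X /dependent_edge[S eS sSX] sXK]; first exact: edge_dependent.
have eqSK := sperner_edges eS eK (subset_trans sSX sXK).
by apply/eqP; rewrite eqEsubset sXK -eqSK.
Qed.

(** Keys are closed under supersets, hence determined by the minimal ones; likewise the dependent
    sets are exactly the supersets of edges. *)
Lemma minimal_keys_edgesP h :
  minimal_keys h = edges e <-> key h =1 (fun K => ~~ independent e K).
Proof.
split=> [minE K | keyE]; last first.
  by apply/setP=> K; rewrite inE (minset_eq K keyE) minset_dependent.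
have minP S : minset (key h) S = (S \in edges e) by rewrite -minE inE.
apply/idP/idP => [/minset_exists[S] | /dependent_edge[S]].
  by rewrite minP => /edge_dependent depS sSK; apply: contra depS; apply: independentS.
by rewrite -minP => /minsetp keyS_ sSK; apply: keyS keyS_.
Qed.

Lemma maximal_independentU I u :
  maximal_independent e I -> u \notin I -> exists2 w, w \in I & e u w.
Proof.
move=> /maxsetP[indI maxI] uI; apply/exists_inP; apply: contraR uI => /exists_inPn nu.
rewrite -(maxI (u |: I)) ?setU11 ?subsetUr //.
apply/independentP=> v w /setU1P[->|vI] /setU1P[->|wI]; rewrite ?e_irr ?nu //.
  by rewrite e_sym nu.
by move/independentP: indI; apply.
Qed.

(** Maximality of [I] gives [u] some neighbor in [I]. Any such neighbor other than [v] would lie in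
    [X] together with [u], against independence. *)
Lemma individual_neighbor_avoiding I X u v :
  maximal_independent e I -> independent e X -> I :\ v \subset X -> u \in X ->
  u \notin I -> neighbors e u :&: I = [set v].
Proof.
move=> maxI /independentP indX sIX uX uI.
have nv w : w \in I -> e u w -> w = v.
  move=> wI; apply: contraTeq => wv; apply: indX => //.
  by apply: (subsetP sIX); rewrite !inE wv.
have [w wI euw] := maximal_independentU maxI uI.
apply/setP=> z; rewrite !inE; apply/andP/eqP => [[euz zI] | ->]; first exact: nv.
by rewrite -(nv w).
Qed.

(** Exchanging [v] for [u] keeps independence, since [v] is the only neighbor of [u] in [I]. A
    maximal extension contains [u], so it omits [v]. *)
Lemma maximal_independent_swap I u v :
  maximal_independent e I -> neighbors e u :&: I = [set v] ->
  exists J, [/\ maximal_independent e J, I :\ v \subset J & v \notin J].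
Proof.
move=> /maxsetp/independentP indI nuE.
have nu w : w \in I -> e u w = (w == v).
  by move=> wI; move/setP/(_ w): nuE; rewrite !inE wI andbT.
have /setIP[euv vI] : v \in neighbors e u :&: I by rewrite nuE set11.
have indIu : independent e (u |: I :\ v).
  apply/independentP=> a b /setU1P[->|/setD1P[av aI]] /setU1P[->|/setD1P[bv bI]].
  - by rewrite e_irr.
  - by rewrite nu.
  - by rewrite e_sym nu.
  - exact: indI.
have [J maxJ sJ] := maxset_exists indIu; exists J; split=> //.
  exact: subset_trans (subsetUr _ _) sJ.
have uJ : u \in J by rewrite (subsetP sJ) ?setU11.
apply: contraL euv => vJ; rewrite inE.
by move/maxsetp/independentP: maxJ; apply.
Qed.

(** * Pure Horn functions whose minimal keys are the edges *)

Definition dependent_clauses : {set {set V} * V} :=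
  [set c | ~~ independent e c.1].

Lemma horn_dependentE x :
  horn dependent_clauses x =
    (support x == setT) || independent e (support x).
Proof.
apply/hornP/orP => [depx | hx A v].
  have [_|depX] := boolP (independent e (support x)); [by right | left].
  by apply/eqP/setP=> v; rewrite in_setT (depx (support x)) ?inE.
rewrite inE /= => depA sAx; case: hx => [/eqP->|indx]; first by rewrite in_setT.
by rewrite (independentS sAx indx) in depA.
Qed.

(** The upper bound on [h] makes every dependent set a key. An independent set lies in a maximal
    one, which is closed and differs from [setT], so it is no key. *)
Lemma pure_horn_minimal_keys h : ~~ independent e setT ->
  (forall x, h x -> horn dependent_clauses x) ->
  (forall I, maximal_independent e I -> h (indicator I)) ->
  minimal_keys h = edges e.
Proof.
move=> depT h_le h_max; apply/minimal_keys_edgesP=> K.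
apply/keyP/idP => [keyK | depK x /h_le hx sKx].
  apply/negP=> /maxset_exists[I maxI sKI].
  have /= := keyK _ (h_max I maxI); rewrite indicatorK => /(_ sKI) IT.
  by move: depT; rewrite -IT (maxsetp maxI).
move: hx; rewrite horn_dependentE => /orP[/eqP// | indx].
by rewrite (independentS sKx indx) in depK.
Qed.

Lemma minimal_keys_le h x : minimal_keys h = edges e -> h x ->
  horn dependent_clauses x.
Proof.
move=> /minimal_keys_edgesP keyE hx; rewrite horn_dependentE orbC -implyNb.
apply/implyP; move: (keyE (support x)) => /= <- /keyP keyx.
by apply/eqP/keyx.
Qed.

(** By maximality the only possible closed supersets of [I] are [I] and [setT]. Were [I] not closed,
    it would be an independent key. *)
Lemma minimal_keys_maximal h I : minimal_keys h = edges e ->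
  maximal_independent e I -> h (indicator I).
Proof.
move=> minE /maxsetP[indI maxI]; have keyE := (minimal_keys_edgesP h).1 minE.
apply: contraT => nhI; suff : key h I by rewrite keyE indI.
apply/keyP=> x hx sIx; apply/eqP.
have := minimal_keys_le minE hx.
rewrite horn_dependentE => /orP[// | /maxI/(_ sIx) xI].
by rewrite -xI supportK hx in nhI.
Qed.

(** * The two implications *)

Lemma unique_key_graph_individual_neighbor I v :
  unique_key_graph e -> maximal_independent e I -> v \in I ->
  exists2 u, u \notin I & neighbors e u :&: I = [set v].
Proof.
move=> [_ [h [[_ minE] uniq_h]]] maxI vI.
have depT : ~~ independent e setT.
  by rewrite -((minimal_keys_edgesP h).1 minE); apply/keyP=> x _; rewrite subTset => /eqP.
suff /exists_inP[u uI /eqP] :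
  [exists u in ~: I, neighbors e u :&: I == [set v]] by exists u; rewrite -?in_setC.
apply: contraT => /exists_inPn no_nbr.
(* Without an individual neighbor of [v], this extra clause leaves the minimal keys unchanged but
   rejects [I :\ v], giving a second function. *)
set C := (I :\ v, v) |: dependent_clauses.
have le_C x : horn C x -> horn dependent_clauses x.
  by move/hornP=> hx; apply/hornP=> A w Aw; apply: hx; rewrite !inE in Aw *; rewrite Aw orbT.
have max_dep J : maximal_independent e J -> horn dependent_clauses (indicator J).
  by move=> maxJ; rewrite horn_dependentE indicatorK (maxsetp maxJ) orbT.
have max_C J : maximal_independent e J -> horn C (indicator J).
  move=> maxJ; apply/hornP=> A w; rewrite indicatorK => /setU1P[[-> ->] sIJ|Aw sAJ].
    (* Either [J] equals [I] and contains [v], or a vertex of [J] outside [I] is an individual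
       neighbor of [v]. *)
    have [sJI | /subsetPn[u uJ uI]] := boolP (J \subset I).
      by move/maxsetP: maxJ => [_ /(_ I (maxsetp maxI) sJI) <-].
    have /eqP nuE := individual_neighbor_avoiding maxI (maxsetp maxJ) sIJ uJ uI.
    by move: (no_nbr u); rewrite in_setC nuE => /(_ uI).
  by have /hornP/(_ A w Aw) := max_dep J maxJ; rewrite indicatorK; apply.
have minC := pure_horn_minimal_keys depT le_C max_C.
have mindep := pure_horn_minimal_keys depT (fun=> id) max_dep.
have eqC : horn C = horn dependent_clauses.
  by rewrite -(uniq_h _ (conj (pure_horn_horn _) minC))
             -(uniq_h _ (conj (pure_horn_horn _) mindep)).
have : horn C (indicator (I :\ v)).
  rewrite eqC horn_dependentE indicatorK.
  by rewrite (independentS (subD1set I v) (maxsetp maxI)) orbT.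
by move/hornP/(_ (I :\ v) v (setU11 _ _)); rewrite indicatorK !inE eqxx => /(_ (subxx _)).
Qed.

Lemma individual_neighbor_unique_key_graph : 0 < #|V| ->
  (forall I, maximal_independent e I -> forall v, v \in I ->
   exists2 u, u \notin I & neighbors e u :&: I = [set v]) ->
  unique_key_graph e.
Proof.
move=> /card_gt0P[v0 _] nbr.
have depT : ~~ independent e setT.
  (* Otherwise [v0] would need an individual neighbor outside [setT]. *)
  apply/negP=> indT; have maxT : maximal_independent e setT.
    by apply/maxsetP; split=> // X _; rewrite subTset => /eqP.
  by have [u] := nbr _ maxT v0 (in_setT _); rewrite in_setT.
(* If a maximal extension of [X] contains [w], the swap at [w] yields one that omits [w] and still
   contains [X]. *)
have separated X w : independent e X -> w \notin X ->
    exists J, [/\ maximal_independent e J, X \subset J & w \notin J].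
  move=> /maxset_exists[I maxI sXI] wX.
  have [wI | wI] := boolP (w \in I); last by exists I.
  have [u _ /(maximal_independent_swap maxI)[J [maxJ sIJ wJ]]] := nbr I maxI w wI.
  by exists J; split=> //; apply: subset_trans sIJ; rewrite subsetD1 sXI.
split; first exact: sperner_edges.
exists (horn dependent_clauses); split=> [|h [horn_h minE]].
  split; first exact: pure_horn_horn.
  apply: pure_horn_minimal_keys => // I maxI.
  by rewrite horn_dependentE indicatorK (maxsetp maxI) orbT.
(* Every candidate [h] lies below the largest function; conversely it accepts the maximal
   independent sets, hence all their intersections. *)
apply/ffunP=> x; apply/idP/idP; last exact: minimal_keys_le.
rewrite -(supportK x) horn_dependentE indicatorK => /orP[/eqP-> | indx].
  by apply: pure_horn_separated => // w; rewrite in_setT.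
apply: pure_horn_separated => // w /(separated _ _ indx)[J [maxJ sxJ wJ]].
by exists J; split=> //; apply: minimal_keys_maximal.
Qed.

End UniqueKeyGraph.

Theorem theorem2 (V : finType) (e : rel V)
    (V_nonempty : 0 < #|V|) (e_sym : symmetric e) (e_irr : irreflexive e) :
  unique_key_graph e <->
  (forall I : {set V}, maximal_independent e I ->
   forall v : V, v \in I ->
   exists2 u : V, u \notin I & neighbors e u :&: I = [set v]).
Proof.
split=> [uniq_e I maxI v|]; first exact: unique_key_graph_individual_neighbor.
exact: individual_neighbor_unique_key_graph.
Qed.
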